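(* Let $N$ be an $\mathbb{N}_0$-valued random variable whose probability mass function belongs to the Panjer $(a,b)$ class, and let $(X_i)_{i\ge 1}$ be an iid sequence of random variables on $\mathbb{N}_0$, independent of $N$. Let $S_N=\sum_{i=1}^{N}X_i$ and $S_{N+1}=\sum_{i=1}^{N+1}X_i$. Let $k\in\mathbb{N}$ and assume $E X_1^k<\infty$. For $r\in\{1,k\}$ and $\ell\in\mathbb{N}$ let $\chi_{r+}(\ell)=E[X_1^r;S_{N+1}=\ell]$. Then $$\chi_{k+}(1)=P(X_1=1)\,E\big[P(X_1=0)^N\big],$$ and for every integer $\ell\ge 2$, $$\chi_{k+}(\ell)=\ell^k P(X_1=\ell)P(S_N=0)+\frac{1}{1-aP(X_1=0)}\sum_{j=1}^{\ell-1}P(X_1=j)\Big\{a\,\chi_{k+}(\ell-j)+\frac{b\,j^k}{\ell-j}\,\chi_{1+}(\ell-j)\Big\}.$$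
   Context: $\mathbb{N}=\{1,2,\ldots\}$ and $\mathbb{N}_0=\{0,1,2,\ldots\}$. The probability mass function $q_n=P(N=n)$ belongs to the Panjer $(a,b)$ class if $q_n=\big(a+\frac{b}{n}\big)q_{n-1}$ for all $n\in\mathbb{N}$, where $a,b$ are real numbers with $a+b\ge 0$ and $a<1$. For a random variable $Y$ and an event $A$, $E[Y;A]:=E[Y\,I_A]$, where $I_A$ is the indicator of $A$. The empty sum is $0$ (so $S_N=0$ when $N=0$), and $0^0=1$ by convention. *)

(* Defs.v *)
From HB Require Import structures.
From mathcomp Require Import all_boot all_order all_algebra finmap.
From mathcomp Require Import all_classical all_reals all_analysis.

Set Implicit Arguments.
Unset Strict Implicit.
Unset Printing Implicit Defensive.

Import Order.TTheory GRing.Theory Num.Theory.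
Import numFieldNormedType.Exports.

Local Open Scope classical_set_scope.
Local Open Scope ring_scope.

Definition panjer (R : realType) (a b : R) (q : nat -> R) : Prop :=
  [/\ 0 <= a + b, a < 1
    & forall n : nat, (0 < n)%N -> q n = (a + b / n%:R) * q n.-1].

Section random_sequences.
Context {d d' : measure_display} {T : measurableType d} {E : measurableType d'}
  {R : realType} (P : probability T R).

Definition mutually_independent (X : nat -> {RV P >-> E}) : Prop :=
  forall (J : {fset nat}) (A : nat -> set E),
    (forall i, measurable (A i)) ->
    P (\bigcap_(i in [set` J]) X i @^-1` A i) =
    (\prod_(i <- J) P (X i @^-1` A i))%E.

Definition identically_distributed (X : nat -> {RV P >-> E}) : Prop :=
  forall i (A : set E), measurable A ->
    distribution P (X i) A = distribution P (X 0%N) A.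

Definition iid (X : nat -> {RV P >-> E}) : Prop :=
  mutually_independent X /\ identically_distributed X.

Definition sigma_of_seq (X : nat -> {RV P >-> E}) : set (set T) :=
  <<s \bigcup_i preimage_set_system [set: T] (X i) measurable >>.

(* The sigma-algebras generated by N and by the whole sequence X are
   independent. *)
Definition independent_of_seq (N : {RV P >-> nat}) (X : nat -> {RV P >-> E}) :
    Prop :=
  forall (A : set nat) (B : set T), measurable A -> sigma_of_seq X B ->
    P (N @^-1` A `&` B) = (P (N @^-1` A) * P B)%E.

End random_sequences.

Section compound_sums.
Context {d : measure_display} {T : measurableType d} {R : realType}
  (P : probability T R).

(* Sequences are indexed from 0: [X i] is the variable X_{i+1}, so the summands
   X_1, ..., X_n are [X 0], ..., [X n.-1]. *)
Definition partial_sum (X : nat -> {RV P >-> nat}) (n : nat) (w : T) : nat :=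
  (\sum_(i < n) X i w)%N.

Definition S_N (N : {RV P >-> nat}) (X : nat -> {RV P >-> nat}) (w : T) : nat :=
  partial_sum X (N w) w.

Definition S_N1 (N : {RV P >-> nat}) (X : nat -> {RV P >-> nat}) (w : T) : nat :=
  partial_sum X (N w).+1 w.

(* E[X_1^r ; S_{N+1} = l] *)
Definition chi (N : {RV P >-> nat}) (X : nat -> {RV P >-> nat}) (r l : nat) :
    \bar R :=
  ('E_P[fun w => ((X 0%N w)%:R ^+ r * \1_[set v | S_N1 N X v = l] w)%R])%E.

End compound_sums.

(* Main.v *)
Require Import Defs.
From HB Require Import structures.
From mathcomp Require Import all_boot all_order all_algebra finmap.
From mathcomp Require Import all_classical all_reals all_analysis.
From mathcomp Require Import measurable_realfun ring.

Set Implicit Arguments.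
Unset Strict Implicit.
Unset Printing Implicit Defensive.

Import Order.TTheory GRing.Theory Num.Theory.
Import numFieldNormedType.Exports.

Local Open Scope classical_set_scope.
Local Open Scope ring_scope.

(** Write p_j for the law of a summand, q_n for the law of N and g_s for the
law of S_N.

Splitting S_{N+1} into X_1 and the N remaining summands, which are
independent of X_1 and have together the law of S_N, gives
  E[X_1^k ; S_{N+1} = l] = sum_{1 <= j <= l} j^k p_j g_{l-j}
([chi_moment_conv]).  For l = 1 only p_1 g_0 is left, and g_0 = E[p_0^N].

For l >= 2 the term j = l is l^k p_l g_0.  In the others, g_{l-j} is expanded
by Panjer's recursion ([panjer_recursion])
  (1 - a p_0) g_m = sum_{1 <= i <= m} (a + b i / m) p_i g_{m-i}   (m >= 1),
which leaves a double sum over i, j >= 1 with i + j <= l.  Its b-part is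
already of the announced form; exchanging the names of i and j in its a-part
puts the weight j^k on the inner summand, so that the inner sum there is
E[X_1^k ; S_{N+1} = l - j] ([moment_conv_recursion]).

Panjer's recursion rests on the exchangeability of the summands: given
X_1 + ... + X_{n+1} = m, each summand has mean m / (n+1).  In terms of
convolution powers this is the coefficient form of
(f^(n+1))' = (n+1) f' f^n for the generating polynomial f of p
([convpow_size_bias]).  Multiplied by q_{n+1} = (a + b/(n+1)) q_n and summed
over n, it gives the recursion.

The probabilistic input is that sums over blocks of summands have the
convolution powers of p as laws ([probability_cylinder_block_sum]), and that an
event that is decided by the summands once N is known has probability
sum_n q_n c_n, where c_n is its probability with N replaced by n
([mixture_cvg]).  All these series are handled as limits of real partial sums,
because a or b may be negative. *)

(** * Convolution powers and Panjer's recursion *)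

Section compound_algebra.
Context {R : realType}.
Implicit Types (p q g : nat -> R) (m n l k : nat).

Fixpoint convpow p n m : R :=
  if n is n'.+1 then \sum_(i < m.+1) p i * convpow p n' (m - i) else (m == 0%N)%:R.

Lemma convpow_at0 p n : convpow p n 0 = p 0%N ^+ n.
Proof.
by elim: n => [|n IHn] //=; rewrite big_ord1 subn0 IHn exprS.
Qed.

(** Only the coefficients of index at most m matter for the m-th coefficient of
a power, so truncating the generating series at any L > m is harmless. *)
Lemma convpow_coef p L n m : (m < L)%N ->
  convpow p n m = ((\poly_(i < L) p i) ^+ n)`_m.
Proof.
elim: n m => [|n IHn] m mL; first by rewrite expr0 coef1.
rewrite exprS coefM /=; apply: eq_bigr => i _.
have im : (i <= m)%N by rewrite -ltnS.
rewrite coef_poly (leq_ltn_trans im mL) -IHn //.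
exact: leq_ltn_trans (leq_subr _ _) mL.
Qed.

(** Compare the coefficients of index m - 1 in (f^(n+1))' = (n+1) f' f^n. *)
Lemma convpow_size_bias p n m :
  m%:R * convpow p n.+1 m =
  n.+1%:R * \sum_(i < m.+1) i%:R * p i * convpow p n (m - i).
Proof.
case: m => [|m]; first by rewrite mul0r big_ord1 !mul0r mulr0.
rewrite (@convpow_coef p m.+2) //; set f := \poly_(_ < _) _.
have -> : m.+1%:R * (f ^+ n.+1)`_m.+1 = ((f ^+ n.+1)^`())`_m.
  by rewrite coef_deriv mulr_natl.
rewrite deriv_exp coefMn -[LHS]mulr_natl; congr (_ * _).
rewrite coefM [RHS]big_ord_recl /= !mul0r add0r.
apply: eq_bigr => i _.
have im : (i <= m)%N by rewrite -ltnS.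
rewrite coef_deriv coef_poly !ltnS im -[p _ *+ _]mulr_natl /bump leq0n add1n subSS.
by rewrite -(@convpow_coef p m.+2) // ltnS leqW // leq_subr.
Qed.

(** The limit is required to exist in the reals, so that real linear
combinations with coefficients of any sign pass to the limit. *)
Definition compound_pmf p q g :=
  forall m, series (fun n => q n * convpow p n m) @ \oo --> g m.

(** The factor a + b/(n+1) of Panjer's recurrence turns into a + b i/m under the
sum over the value i of one summand, by [convpow_size_bias]; the latter factor
no longer depends on n and leaves the series. *)
Lemma panjer_recursion (a b : R) p q g : panjer a b q -> compound_pmf p q g ->
  forall m, (0 < m)%N ->
  (1 - a * p 0%N) * g m =
  \sum_(1 <= i < m.+1) (a + b * i%:R / m%:R) * p i * g (m - i)%N.
Proof.
move=> [_ _ qrec] gE m m0.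
have m0R : m%:R != 0 :> R by rewrite pnatr_eq0 -lt0n.
pose c (i : nat) := (a + b * i%:R / m%:R) * p i.
have termE n : q n.+1 * convpow p n.+1 m =
    \sum_(i < m.+1) c i * (q n * convpow p n (m - i)).
  have n0 : n.+1%:R != 0 :> R by rewrite pnatr_eq0.
  have bias : convpow p n.+1 m / n.+1%:R =
      (\sum_(i < m.+1) i%:R * p i * convpow p n (m - i)) / m%:R.
    apply: (mulfI m0R); rewrite mulrA convpow_size_bias.
    by rewrite mulrAC mulfV // mul1r mulrCA mulfV // mulr1.
  have -> : q n.+1 * convpow p n.+1 m =
      q n * (a * convpow p n.+1 m + b * (convpow p n.+1 m / n.+1%:R)).
    by rewrite qrec //=; ring.
  rewrite bias /= mulr_suml !mulr_sumr -big_split /= mulr_sumr.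
  by apply: eq_bigr => i _; rewrite /c; ring.
(* The term n = 0 vanishes because the empty sum is not m > 0, so the series
   may start at n = 1, where the recurrence for q applies. *)
have shifted : (fun n => series (fun n => q n * convpow p n m) n.+1) =
    (fun n => \sum_(i < m.+1) c i * series (fun n => q n * convpow p n (m - i)) n).
  apply/funext => n.
  rewrite /series /= big_nat_recl // /= gtn_eqF // mulr0 add0r.
  rewrite (eq_bigr _ (fun i _ => termE i)) exchange_big /=.
  by apply: eq_bigr => i _; rewrite mulr_sumr.
have lim1 : (fun n => series (fun n => q n * convpow p n m) n.+1) @ \oo --> g m.
  by rewrite cvg_shiftS; exact: gE.
have lim2 : (fun n => \sum_(i < m.+1)
      c i * series (fun n => q n * convpow p n (m - i)) n) @ \oo -->
    \sum_(i < m.+1) c i * g (m - i)%N.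
  apply: cvg_big => [|i _]; first exact: add_continuous.
  by apply: cvgMr; exact: gE.
rewrite shifted in lim1.
have gm : g m = \sum_(i < m.+1) c i * g (m - i)%N.
  exact: cvg_unique lim1 lim2.
(* The term i = 0 of this identity is a p_0 g_m, which moves to the left. *)
rewrite mulrBl mul1r {1}gm -(big_mkord xpredT (fun i => c i * g (m - i)%N)).
by rewrite big_ltn // subn0 {1}/c mulr0 mul0r addr0 addrC addKr.
Qed.

(** This is E[Y^k ; Y + S = l] for k > 0 and independent Y and S with laws p
and g; at k > 0 the value Y = 0 contributes nothing. *)
Definition moment_conv p g k l : R := \sum_(1 <= j < l.+1) j%:R ^+ k * p j * g (l - j)%N.

(** Panjer's recursion enters only as a hypothesis on g: the statement is an
exchange in a sum over the triangle i, j >= 1, i + j <= l. *)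
Lemma moment_conv_recursion (a b : R) p g k l :
  1 - a * p 0%N != 0 ->
  (forall m, (0 < m)%N -> (1 - a * p 0%N) * g m =
    \sum_(1 <= i < m.+1) (a + b * i%:R / m%:R) * p i * g (m - i)%N) ->
  (0 < l)%N ->
  moment_conv p g k l = l%:R ^+ k * p l * g 0%N +
   (1 - a * p 0%N)^-1 * \sum_(1 <= j < l)
      p j * (a * moment_conv p g k (l - j) +
             (b * j%:R ^+ k / (l - j)%:R) * moment_conv p g 1 (l - j)).
Proof.
move=> D0 grec l0.
rewrite {1}/moment_conv big_nat_recr //= subnn addrC; congr (_ + _).
apply: (mulfI D0); rewrite mulVKf // mulr_sumr.
have tri (F : nat -> nat -> R) :
    \sum_(1 <= j < l) \sum_(1 <= i < (l - j).+1) F i j =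
    \sum_(1 <= j < l) \sum_(1 <= i < (l - j).+1) F j i.
  (* Both sums run over the same symmetric region of the square [1, l)^2. *)
  have widen (G : nat -> nat -> R) : \sum_(1 <= j < l) \sum_(1 <= i < (l - j).+1) G i j =
     \sum_(1 <= j < l) \sum_(1 <= i < l | (i + j <= l)%N) G i j.
    apply: eq_big_nat => j /andP[j1 jl].
    rewrite (big_nat_widen _ _ l) /=; last by rewrite ltn_subrL j1.
    by apply: eq_bigl => i; rewrite ltnS leq_subRL ?(ltnW jl) // addnC.
  rewrite !widen (exchange_big_dep_nat xpredT) //=.
  by apply: eq_bigr => i _; apply: eq_bigl => j; rewrite addnC.
transitivity (\sum_(1 <= j < l) \sum_(1 <= i < (l - j).+1)
   (a * p j * (i%:R ^+ k * p i * g (l - j - i)%N) +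
    b * j%:R ^+ k / (l - j)%:R * p j * (i%:R ^+ 1 * p i * g (l - j - i)%N))); last first.
  apply: eq_bigr => j _; rewrite big_split /= -!mulr_sumr mulrDr /moment_conv.
  by congr (_ + _); rewrite mulrCA !mulrA.
under [RHS]eq_bigr do rewrite big_split /=.
rewrite big_split /= tri -big_split /=.
apply: eq_big_nat => j /andP[j1 jl].
rewrite [LHS]mulrCA grec ?subn_gt0 // mulr_sumr -big_split /=.
apply: eq_bigr => i _.
rewrite expr1 (subnAC l i j); ring.
Qed.
End compound_algebra.

(** * Events about finitely many summands *)

Section initial_values_and_block_sums.
Context {d : measure_display} {U : measurableType d} (Y : nat -> U -> nat).

Definition cylinder (x : nat -> nat) (m : nat) : set U :=
  \bigcap_(i < m) Y i @^-1` [set x i].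

Definition block_sum (m n : nat) (w : U) : nat := (\sum_(m <= i < m + n) Y i w)%N.

(** The space U is left abstract because the lemma is applied twice: with the
given sigma-algebra, and with the one that the summands generate. *)
Lemma measurable_cylinder_block_sum x m n s : (forall i, measurable_fun setT (Y i)) ->
  measurable (cylinder x m `&` block_sum m n @^-1` [set s]).
Proof.
move=> mY; apply: measurableI.
  apply: bigcap_measurableType => i _.
  by rewrite -[X in measurable X]setTI; exact: mY.
rewrite -[X in measurable X]setTI.
suff: measurable_fun setT (block_sum m n) by move=> h; exact: h.
elim: n m => [|n IHn] m.
  apply: (eq_measurable_fun (cst 0%N)) => // w _.
  by rewrite /block_sum addn0 big_geq.
apply: (eq_measurable_fun (fun w => (Y m w + block_sum m.+1 n w)%N)).
  by move=> w _; rewrite /block_sum addSnnS [RHS]big_ltn // -addSnnS leq_addr.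
exact: measurable_fun_addn.
Qed.

(** Moving the value j of the first variable of the block into the cylinder
shortens the block; the cylinder thus carries the induction hypothesis through
the independence property, which speaks of single variables only. *)
Lemma block_sum_first_step x m n s :
  cylinder x m `&` block_sum m n.+1 @^-1` [set s] =
  \bigcup_(j < s.+1)
    (cylinder (fun i => if i == m then j else x i) m.+1 `&`
     block_sum m.+1 n @^-1` [set (s - j)%N]).
Proof.
have stepE w : block_sum m n.+1 w = (Y m w + block_sum m.+1 n w)%N.
  by rewrite /block_sum addSnnS big_ltn // -addSnnS leq_addr.
apply/seteqP; split=> w.
  move=> [cw]; rewrite /= stepE => sw; exists (Y m w).
    by rewrite /= ltnS -sw leq_addr.
  split; last by rewrite /= -sw addKn.
  move=> i /=; rewrite ltnS leq_eqVlt; case: eqP => [-> //|_] /= im.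
  exact: cw.
move=> [j] /= js [cw bw]; split.
  by move=> i /= im; have := cw i (ltnW im); rewrite /= ltn_eqF.
have /= := cw m (ltnSn m); rewrite eqxx => Ym.
by rewrite stepE Ym bw subnKC.
Qed.

Lemma trivIset_first_step x m n s :
  trivIset setT (fun j : nat =>
    cylinder (fun i => if i == m then j else x i) m.+1 `&`
    block_sum m.+1 n @^-1` [set (s - j)%N]).
Proof.
move=> j j' _ _ [w [[/(_ m (ltnSn m)) + _] [/(_ m (ltnSn m)) + _]]].
by rewrite /= !eqxx => -> ->.
Qed.

End initial_values_and_block_sums.

(** * Laws of sums of iid summands *)

Section iid_sums.
Context {d : measure_display} {T : measurableType d} {R : realType}
  (P : probability T R) (X : nat -> {RV P >-> nat}).
Context (iidX : iid X).

Definition summand_pmf (j : nat) : R := fine (P [set w | X 0%N w = j]).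
Local Notation p := summand_pmf.

Lemma measurable_RV (Y : {RV P >-> nat}) (A : set nat) : measurable (Y @^-1` A).
Proof. by rewrite -[X in measurable X]setTI; exact: measurable_funPT. Qed.

Lemma probability_fineK (A : set T) : measurable A -> P A = (fine (P A))%:E.
Proof. by move=> mA; rewrite fineK // fin_num_measure. Qed.

Lemma summand_pmfE i j : P (X i @^-1` [set j]) = (p j)%:E.
Proof.
have [_ /(_ i [set j])] := iidX.
rewrite /distribution /pushforward => -> //.
by rewrite probability_fineK //; exact: measurable_RV.
Qed.

(** The first m variables are an instance of the finite subfamilies in
[mutually_independent], with events that are singletons. *)
Lemma probability_cylinder x m :
  P (cylinder X x m) = (\prod_(i < m) p (x i))%:E.
Proof.
have [ind _] := iidX.
pose J := seq_fset tt (iota 0 m).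
have /= := ind J (fun i => [set x i]) (fun i => I).
have -> : \bigcap_(i in [set` J]) X i @^-1` [set x i] = cylinder X x m.
  by congr bigcap; apply/seteqP; split=> i /=; rewrite seq_fsetE mem_iota.
move=> ->; rewrite -prodEFin.
rewrite (perm_big (index_iota 0 m)) /=.
  rewrite big_mkord.
  by apply: eq_bigr => i _; exact: summand_pmfE.
apply: uniq_perm; rewrite ?sort_keys_uniq ?iota_uniq // => i.
by rewrite -[LHS]/(i \in J) seq_fsetE /index_iota subn0.
Qed.

(** Induction on the length of the block: decomposing along the first value of
the block is exactly one step of the recursion that defines [convpow]. *)
Lemma probability_cylinder_block_sum x m n s :
  P (cylinder X x m `&` block_sum X m n @^-1` [set s]) =
  (\prod_(i < m) p (x i) * convpow p n s)%:E.
Proof.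
have mX i : measurable_fun setT (X i) by exact: measurable_funPT.
elim: n m x s => [|n IHn] m x s.
  rewrite [convpow _ _ _]/=.
  have b0 w : block_sum X m 0 w = 0%N by rewrite /block_sum addn0 big_geq.
  case: (eqVneq s 0%N) => [->|s0].
    rewrite mulr1 -probability_cylinder; congr (P _).
    by apply/seteqP; split=> [w []//|w cw]; split => //=; rewrite b0.
  rewrite mulr0 -[RHS](measure0 P); congr (P _).
  by rewrite -subset0 => w [_ /=]; rewrite b0 => /esym/eqP; rewrite (negbTE s0).
rewrite block_sum_first_step bigcup_mkord.
pose F (j : nat) := cylinder X (fun i => if i == m then j else x i) m.+1 `&`
  block_sum X m.+1 n @^-1` [set (s - j)%N].
have mF j : measurable (F j) by exact: measurable_cylinder_block_sum.
have tF : trivIset setT F by exact: trivIset_first_step.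
rewrite [LHS](measure_bigsetU P mF tF).
rewrite (eq_bigr _ (fun j _ => IHn _ _ _)) sumEFin /= mulr_sumr.
congr (_%:E); apply: eq_bigr => j _.
rewrite big_ord_recr /= eqxx mulrA; congr (_ * _ * _).
by apply: eq_bigr => i _; rewrite ltn_eqF.
Qed.

(** * The law of the compound sum *)

Context (N : {RV P >-> nat}) (indNX : independent_of_seq N X).
Local Notation q := (fun n => fine (P [set w | N w = n])).

(** Decompose E along the value n of N; on each piece E agrees with the event
B n, which is independent of N. *)
Lemma mixture_cvg (E : set T) (B : nat -> set T) (c : nat -> R) :
  (forall n, sigma_of_seq X (B n)) ->
  (forall n, P (B n) = (c n)%:E) ->
  (forall w, E w <-> B (N w) w) ->
  measurable E /\ series (fun n => q n * c n) @ \oo --> fine (P E).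
Proof.
move=> sB PB EB.
have sub B' : sigma_of_seq X B' -> measurable B'.
  move: B'; apply: smallest_sub.
    split; [exact: measurable0 | by move=> A mA; rewrite setTD; exact: measurableC |].
    by move=> A mA; exact: bigcup_measurable.
  by move=> _ [i _ [A _ <-]]; rewrite setTI; exact: measurable_RV.
pose F n := N @^-1` [set n] `&` B n.
have mF n : measurable (F n).
  by apply: measurableI; [exact: measurable_RV | exact: sub].
have EF : E = \bigcup_n F n.
  apply/seteqP; split=> [w /EB Bw|w [n _ [/= Nw Bw]]].
    by exists (N w).
  by apply/EB; rewrite Nw.
have mE : measurable E by rewrite EF; exact: bigcup_measurable.
split=> //.
have tF : trivIset setT F by apply: trivIset_setIr; exact: trivIset_preimage1.
have := measure_semi_sigma_additive F mF tF.
move=> /(_ R P); rewrite -EF => /(_ mE) cvP.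
have -> : series (fun n => q n * c n) = fine \o (fun n => \sum_(0 <= i < n) P (F i))%E.
  apply/funext => n /=; rewrite /series /=.
  rewrite (eq_bigr (fun i => (q i * c i)%:E)) ?sumEFin // => i _.
  rewrite /F indNX // PB EFinM -probability_fineK //.
  exact: (measurable_RV N [set i]).
by apply: fine_cvg; rewrite -probability_fineK.
Qed.

(** On the space endowed with the generated sigma-algebra every X i is still
measurable, hence so are the events of [measurable_cylinder_block_sum]. *)
Lemma sigma_of_seq_cylinder_block_sum x m n s :
  sigma_of_seq X (cylinder X x m `&` block_sum X m n @^-1` [set s]).
Proof.
pose U := g_sigma_algebraType (\bigcup_i preimage_set_system [set: T] (X i) measurable).
have mX i : measurable_fun setT (X i : U -> nat).
  move=> _ A mA; apply: sub_gen_smallest; exists i => //; exists A => //.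
exact: (measurable_cylinder_block_sum x m n s mX).
Qed.

Definition compound_sum_pmf (s : nat) : R := fine (P [set w | S_N N X w = s]).
Local Notation g := compound_sum_pmf.

Lemma block_sum_partial_sum n w : block_sum X 0 n w = partial_sum X n w.
Proof. by rewrite /block_sum /partial_sum big_mkord. Qed.

Lemma partial_sumSl n w : partial_sum X n.+1 w = (X 0%N w + block_sum X 1 n w)%N.
Proof.
by rewrite -block_sum_partial_sum /block_sum !add0n add1n big_ltn.
Qed.

Lemma compound_sum_mixture s :
  measurable [set w | S_N N X w = s] /\
  series (fun n => q n * convpow p n s) @ \oo --> g s.
Proof.
apply: mixture_cvg.
- by move=> n; exact: (sigma_of_seq_cylinder_block_sum (fun=> 0%N) 0 n s).
- by move=> n; rewrite probability_cylinder_block_sum big_ord0 mul1r.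
- move=> w; rewrite /= block_sum_partial_sum; split=> [Sw|[]//].
  by split.
Qed.

Lemma compound_sum_pmfP : compound_pmf p q g.
Proof. by move=> s; exact: (compound_sum_mixture s).2. Qed.

Lemma compound_sum_pmfE s : P [set w | S_N N X w = s] = (g s)%:E.
Proof. by apply: probability_fineK; exact: (compound_sum_mixture s).1. Qed.

(** Given N = n, the event fixes X_1 and the sum of the n following summands,
hence has probability p_j times the one of a sum of n summands being s. *)
Lemma first_summand_and_shifted_sum j s :
  measurable [set w | X 0%N w = j /\ S_N1 N X w = (j + s)%N] /\
  P [set w | X 0%N w = j /\ S_N1 N X w = (j + s)%N] = (p j * g s)%:E.
Proof.
have [mE cvE] : measurable [set w | X 0%N w = j /\ S_N1 N X w = (j + s)%N] /\
    series (fun n => q n * (p j * convpow p n s)) @ \oo -->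
    fine (P [set w | X 0%N w = j /\ S_N1 N X w = (j + s)%N]).
  apply: mixture_cvg.
  - by move=> n; exact: (sigma_of_seq_cylinder_block_sum (fun=> j) 1 n s).
  - by move=> n; rewrite probability_cylinder_block_sum big_ord1.
  - move=> w /=; rewrite /S_N1 partial_sumSl; split.
      move=> [X0 /eqP]; rewrite X0 eqn_add2l => /eqP bs.
      by split=> // i /=; rewrite ltnS leqn0 => /eqP ->.
    by move=> [/(_ 0%N (ltnSn 0)) /= X0 bs]; rewrite X0 bs.
split=> //; rewrite probability_fineK //; congr (_%:E).
have cvg2 : series (fun n => q n * (p j * convpow p n s)) @ \oo --> p j * g s.
  have -> : series (fun n => q n * (p j * convpow p n s)) =
      (fun n => p j * series (fun n => q n * convpow p n s) n).
    apply/funext => n; rewrite /series /= mulr_sumr.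
    by apply: eq_bigr => i _; rewrite mulrCA.
  by apply: cvgMr; exact: compound_sum_pmfP.
exact: cvg_unique cvE cvg2.
Qed.

(** On S_{N+1} = l the first summand takes one of the values 0, ..., l, so the
integrand is a finite combination of indicators; k > 0 removes the value 0. *)
Lemma chi_moment_conv k l : (0 < k)%N -> chi N X k l = (moment_conv p g k l)%:E.
Proof.
move=> k0.
pose E j := [set w | X 0%N w = j /\ S_N1 N X w = l].
have EP j : (j <= l)%N -> measurable (E j) /\ P (E j) = (p j * g (l - j)%N)%:E.
  by move=> jl; have := first_summand_and_shifted_sum j (l - j); rewrite subnKC.
have mE (j : 'I_l.+1) : measurable (E j) by have [] := EP j (leq_ord j).
rewrite /chi unlock.
transitivity (\int[P]_w \sum_(j < l.+1) ((j%:R ^+ k)%:E * (\1_(E j) w)%:E))%E.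
  apply: eq_integral => w _.
  rewrite (eq_bigr (fun j : 'I_l.+1 => (j%:R ^+ k * \1_(E j) w)%:E)) //.
  rewrite sumEFin; congr (_%:E).
  have [Sl|Sl] := eqVneq (S_N1 N X w) l; last first.
    rewrite indicE memNset ?mulr0; last by move=> /= /eqP; rewrite (negbTE Sl).
    rewrite big1 // => j _; rewrite indicE memNset ?mulr0 //.
    by move=> [_ /eqP]; rewrite (negbTE Sl).
  have X0l : (X 0%N w < l.+1)%N.
    by rewrite ltnS -Sl /S_N1 partial_sumSl leq_addr.
  rewrite (bigD1 (Ordinal X0l)) //= big1 ?addr0.
    by rewrite !indicE !mem_set.
  move=> j jX; rewrite indicE memNset ?mulr0 // => -[X0j _].
  by move/eqP: jX; apply; apply: val_inj; rewrite /= X0j.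
have mI (j : 'I_l.+1) : measurable_fun setT (fun w => (\1_(E j) w : R)%:E).
  exact/measurable_EFinP/measurable_indic.
rewrite ge0_integral_sum //; last first.
- by move=> j; exact: measurable_funeM.
rewrite (eq_bigr (fun j : 'I_l.+1 => (j%:R ^+ k * p j * g (l - j)%N)%:E)); last first.
  move=> j _; rewrite ge0_integralZl_EFin ?exprn_ge0 //.
  rewrite integral_indic // setIT; have [_ PE] := EP j (leq_ord j).
  by rewrite [X in (_ * X)%E]PE -EFinM mulrA.
rewrite sumEFin; congr (_%:E).
rewrite -(big_mkord xpredT (fun j => j%:R ^+ k * p j * g (l - j)%N)).
by rewrite big_ltn // expr0n gtn_eqF // !mul0r add0r.
Qed.

(** The sum of n summands vanishes with probability p_0^n, so both sides are
the series of the q_n p_0^n. *)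
Lemma expectation_power_compound : ('E_P[fun w => (p 0%N ^+ N w)%R] = (g 0%N)%:E)%E.
Proof.
rewrite unlock.
have -> : [set: T] = \bigcup_n N @^-1` [set n].
  by apply/seteqP; split=> // w _; exists (N w).
rewrite ge0_integral_bigcup; last first.
- exact: trivIset_preimage1.
- by move=> w _; rewrite lee_fin exprn_ge0 // fine_ge0.
- apply: measurable_funTS; apply/measurable_EFinP.
  apply: (measurableT_comp (f := fun n : nat => p 0%N ^+ n) (g := N)) => //.
- by move=> n; exact: measurable_RV.
apply: cvg_lim => //.
have -> : (fun n => \sum_(0 <= i < n) \int[P]_(w in N @^-1` [set i]) (p 0%N ^+ N w)%:E)%E
    = EFin \o series (fun n => q n * convpow p n 0).
  apply/funext => n /=; rewrite /series /= -sumEFin; apply: eq_bigr => i _.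
  rewrite (eq_integral (cst (p 0%N ^+ i)%:E)); last first.
    by move=> w; rewrite inE /= => ->.
  rewrite integral_cst; last exact: measurable_RV.
  rewrite convpow_at0 mulrC EFinM -probability_fineK //.
  exact: (measurable_RV N [set i]).
by apply: cvg_EFin; [exact: nearW | exact: compound_sum_pmfP].
Qed.

End iid_sums.

(** * The recursion for the weighted probabilities *)

Local Open Scope ereal_scope.

Theorem theorem2p3 (d : measure_display) (T : measurableType d) (R : realType)
    (P : probability T R) (a b : R)
    (N : {RV P >-> nat}) (X : nat -> {RV P >-> nat}) (k : nat)
    (hN : panjer a b (fun n => fine (P [set w | N w = n])))
    (hX : iid X)
    (hNX : independent_of_seq N X)
    (hk : (0 < k)%N)
    (hmom : 'E_P[fun w => ((X 0%N w)%:R ^+ k)%R] < +oo) :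
  chi N X k 1 =
    P [set w | X 0%N w = 1%N] *
    'E_P[fun w => (fine (P [set v | X 0%N v = 0%N]) ^+ N w)%R]
  /\
  forall l : nat, (2 <= l)%N ->
    chi N X k l =
      (l%:R ^+ k)%:E * P [set w | X 0%N w = l] * P [set w | S_N N X w = 0%N]
      + ((1 - a * fine (P [set w | X 0%N w = 0%N]))^-1)%:E *
        \sum_(1 <= j < l)
          P [set w | X 0%N w = j] *
          (a%:E * chi N X k (l - j)
           + (b * j%:R ^+ k / (l - j)%:R)%:E * chi N X 1 (l - j)).
Proof.
set p := summand_pmf X; set g := compound_sum_pmf X N.
have chiE r l : (0 < r)%N -> chi N X r l = (moment_conv p g r l)%:E.
  exact: chi_moment_conv.
have pE j : P [set w | X 0%N w = j] = (p j)%:E by exact: summand_pmfE.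
split.
  rewrite chiE // pE (expectation_power_compound hX hNX) -EFinM; congr (_%:E).
  by rewrite /moment_conv big_nat1 expr1n mul1r subnn.
move=> l l2.
have D0 : (1 - a * p 0%N != 0 :> R)%R.
  have [_ a1 _] := hN.
  have p0 : (0 <= p 0%N)%R by exact: fine_ge0.
  have p1 : (p 0%N <= 1)%R.
    rewrite -lee_fin -pE; apply: probability_le1.
    exact: (measurable_RV (X 0%N) [set 0%N]).
  rewrite subr_eq0 eq_sym lt_eqF //.
  have [->|p0_neq0] := eqVneq (p 0%N) 0%R; first by rewrite mulr0 ltr01.
  have p0_gt0 : (0 < p 0%N)%R by rewrite lt0r p0_neq0.
  by apply: lt_le_trans p1; rewrite gtr_pMl.
rewrite chiE // (moment_conv_recursion (b := b) k D0) ?(ltnW l2) //; last first.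
  exact: panjer_recursion hN (compound_sum_pmfP hX hNX).
rewrite pE (compound_sum_pmfE hX hNX) -/g /=.
have -> : \sum_(1 <= j < l) P [set w | X 0%N w = j] *
    (a%:E * chi N X k (l - j) +
     (b * j%:R ^+ k / (l - j)%:R)%:E * chi N X 1 (l - j)) =
  (\sum_(1 <= j < l) p j * (a * moment_conv p g k (l - j) +
     b * j%:R ^+ k / (l - j)%:R * moment_conv p g 1 (l - j)))%:E.
  by rewrite -sumEFin; apply: eq_bigr => j _; rewrite pE !chiE.
by rewrite -!EFinM -EFinD.
Qed.
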